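(* Let $G$ be a finite undirected graph (possibly with loops and multiple edges) with nonempty vertex set $V$ and edge set $E$, and let $b\in\mathbb{R}^V$ be nonzero with all entries nonnegative. Let $u$ be an element of $\mathcal{P}(G,b)$, and let $H=\mathrm{gr}(u)$ be the graph of $u$. Then the following are equivalent: (i) $u$ is a vertex of the polytope $\mathcal{P}(G,b)$; (ii) $u$ is the only element of $\mathcal{P}(G,b)$ whose graph is $H$; (iii) $u$ is the only element of $\mathcal{P}(G,b)$ whose graph is contained in $H$.
   Context: $\delta_G(v)$ denotes the set of edges of $G$ incident with $v$; a loop at $v$ appears once in $\delta_G(v)$. $\mathcal{P}(G,b)=\{x\in\mathbb{R}^E \mid x_e\ge 0 \text{ for each } e\in E,\ \sum_{e\in\delta_G(v)}x_e=b_v \text{ for each } v\in V\}$ (empty when $E=\emptyset$, since $b\ne0$). For $x\in\mathcal{P}(G,b)$, the graph $\mathrm{gr}(x)$ of $x$ is the spanning subgraph of $G$ (vertex set $V$) with edge set $\{e\in E\mid x_e>0\}$. Containment of spanning subgraphs of $G$ means containment of their edge sets. *)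

(* Defs.v *)
From mathcomp Require Export all_boot all_order all_algebra.
From mathcomp Require Export boolp classical_sets reals.

Set Implicit Arguments.
Unset Strict Implicit.
Unset Printing Implicit Defensive.

Import Order.TTheory GRing.Theory Num.Theory.

Local Open Scope ring_scope.
Local Open Scope classical_set_scope.

(* [ends e] is the set of endpoints of [e]: a singleton exactly when [e] is a
   loop.  Distinct edges may have the same endpoints. *)
Record multigraph := Multigraph {
  vert : finType;
  edge : finType;
  ends : edge -> {set vert};
  ends_card : forall e, (1 <= #|ends e| <= 2)%N
}.

(* As a set of edges, so a loop at [v] is counted once. *)
Definition incident (G : multigraph) (v : vert G) : {set edge G} :=
  [set e | v \in ends e]%SET.

(* [R^o] is [R] seen as a module over itself; it gives R^E its vector space
   structure. *)
Definition bpolytope (R : realType) (G : multigraph)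
    (b : {ffun vert G -> R}) : set {ffun edge G -> R^o} :=
  [set x | (forall e, 0 <= (x e : R)) /\
           (forall v, \sum_(e in incident v) (x e : R) = b v)].

(* A spanning subgraph of [G] has vertex set [vert G], so it is represented by
   its edge set; containment is inclusion of edge sets. *)
Definition spanning_subgraph (G : multigraph) := {set edge G}.

Definition gr (R : realType) (G : multigraph)
    (x : {ffun edge G -> R^o}) : spanning_subgraph G :=
  [set e | 0 < (x e : R)]%SET.

(* Vertices of a polytope as extreme points: points of [P] that do not lie
   strictly between two distinct points of [P]. *)
Definition is_vertex (R : realType) (M : lmodType R) (P : set M) (u : M) :=
  P u /\
  forall (x y : M) (t : R), P x -> P y -> 0 < t < 1 ->
    u = t *: x + (1 - t) *: y -> x = y.

(* Main.v *)
(* Everything rests on two facts about supports: the graph of a proper convex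
   combination of x and y is the union of the graphs of x and y, and if gr x is
   contained in gr u then the segment from x to u can be prolonged slightly
   beyond u without leaving the nonnegative orthant. *)
Require Import Defs.
From mathcomp Require Import lra.
Import Order.TTheory GRing.Theory Num.Theory.
Local Open Scope ring_scope.
Local Open Scope classical_set_scope.

(** Both weights are positive and all coordinates nonnegative, so nothing can cancel. *)
Lemma gr_conv (R : realType) (G : multigraph) (x y : {ffun edge G -> R^o})
    (t : R) :
  (forall e, 0 <= (x e : R)) -> (forall e, 0 <= (y e : R)) -> 0 < t < 1 ->
  gr (t *: x + (1 - t) *: y) = (gr x :|: gr y)%SET.
Proof.
move=> x0 y0 /andP[t0 t1]; apply/setP => e; rewrite !inE !ffunE.
have s0 : 0 < 1 - t by rewrite subr_gt0.
have := x0 e; have := y0 e; rewrite !le0r.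
rewrite /GRing.scale /=.
case/orP => [/eqP ->|ye]; case/orP => [/eqP ->|xe].
- by rewrite !mulr0 addr0 ltxx.
- by rewrite mulr0 addr0 pmulr_rgt0 // xe.
- by rewrite mulr0 add0r pmulr_rgt0 // ye orbT.
- by rewrite xe addr_gt0 ?mulr_gt0.
Qed.

(** The degree equations survive any affine combination. A weight may be negative, which allows
    leaving the segment from [x] to [y], so nonnegativity is left as a premise. *)
Lemma bpolytope_affine (R : realType) (G : multigraph)
    (b : {ffun vert G -> R}) (x y : {ffun edge G -> R^o}) (s t : R) :
  bpolytope b x -> bpolytope b y -> s + t = 1 ->
  (forall e, 0 <= s * x e + t * y e) -> bpolytope b (s *: x + t *: y).
Proof.
move=> [_ xb] [_ yb] st1 ge0; split=> [e|v]; first by rewrite !ffunE; exact: ge0.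
under eq_bigr => e _ do rewrite !ffunE.
by rewrite big_split /= -!mulr_sumr xb yb -mulrDl st1 mul1r.
Qed.

Lemma bpolytope_conv (R : realType) (G : multigraph)
    (b : {ffun vert G -> R}) (x y : {ffun edge G -> R^o}) (t : R) :
  bpolytope b x -> bpolytope b y -> 0 < t < 1 ->
  bpolytope b (t *: x + (1 - t) *: y).
Proof.
move=> Px Py /andP[t0 t1]; apply: bpolytope_affine => //; first by rewrite addrC subrK.
by move=> e; rewrite addr_ge0 ?mulr_ge0 ?subr_ge0 ?(ltW t0) ?(ltW t1) ?Px.1 ?Py.1.
Qed.

Lemma exists_scale_le (R : realType) (G : multigraph)
    (x u : {ffun edge G -> R^o}) :
  (forall e, 0 <= (x e : R)) -> (forall e, 0 <= (u e : R)) ->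
  gr x \subset gr u ->
  exists2 t : R, 0 < t < 1 & forall e, t * x e <= u e.
Proof.
move=> x0 u0 /fintype.subsetP xu.
(* Where [u e = 0] the quotient is [0]. *)
pose r e : R := (x e : R) / (u e : R).
have r0 e : 0 <= r e by rewrite divr_ge0.
have S0 : 0 <= \sum_e r e by apply: sumr_ge0.
have M0 : 0 < 2 + \sum_e r e by rewrite ltr_wpDr.
(* The sum bounds every single ratio [r e]; the summand 2 keeps the inverse below 1 even when all
   ratios vanish. *)
exists (2 + \sum_e r e)^-1.
  rewrite invr_gt0 M0 invf_lt1 //; lra.
move=> e; rewrite ler_pdivrMl //.
have := x0 e; rewrite le0r => /orP[/eqP ->|xe]; first by rewrite mulr_ge0 // ltW.
have ue : 0 < (u e : R) by have := xu e; rewrite !inE => ->.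
rewrite -ler_pdivrMr // -/(r e) (bigD1 e) //=.
have : 0 <= \sum_(i | i != e) r i by apply: sumr_ge0.
lra.
Qed.

Lemma is_vertex_gr_sub (R : realType) (G : multigraph)
    (b : {ffun vert G -> R}) (u x : {ffun edge G -> R^o}) :
  is_vertex (bpolytope b) u -> bpolytope b x -> gr x \subset gr u -> x = u.
Proof.
move=> [Pu ext] Px xu.
have [t t01 tle] := exists_scale_le _ _ _ _ Px.1 Pu.1 xu.
have s0 : 0 < 1 - t by rewrite subr_gt0; case/andP: t01.
have sN0 : 1 - t != 0 by rewrite gt_eqF.
(* The point beyond [u] on the line from [x], obtained by solving [u = t *: x + (1 - t) *: y] for
   [y]. Its coordinates are nonnegative because [t * x e <= u e]. *)
pose y := (1 - t)^-1 *: u + - ((1 - t)^-1 * t) *: x.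
have Py : bpolytope b y.
  apply: bpolytope_affine => //.
    by rewrite -{1}[(1 - t)^-1]mulr1 -mulrBr mulVf.
  move=> e; rewrite mulNr -mulrA -mulrBr mulr_ge0 ?subr_ge0 //.
  by rewrite invr_ge0 ltW.
have uE : u = t *: x + (1 - t) *: y.
  rewrite scalerDr !scalerA mulfV // scale1r mulrN mulrA mulfV // mul1r.
  by rewrite scaleNr addrC subrK.
have xy := ext x y t Px Py t01 uE.
by rewrite uE -xy -scalerDl [t + _]addrC subrK scale1r.
Qed.

(** All points strictly between [x] and [y] have the same graph, so uniqueness makes them coincide,
    which forces [x = y]. *)
Lemma is_vertex_gr_eq (R : realType) (G : multigraph)
    (b : {ffun vert G -> R}) (u : {ffun edge G -> R^o}) :
  bpolytope b u -> (forall x, bpolytope b x -> gr x = gr u -> x = u) ->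
  is_vertex (bpolytope b) u.
Proof.
move=> Pu uniq; split=> // x y t Px Py t01 uE.
have [t0 t1] := andP t01.
(* Any parameter in the open unit interval other than [t] would serve. *)
have h01 : 0 < t / 2 < 1 by lra.
have zu : (t / 2) *: x + (1 - t / 2) *: y = u.
  apply: uniq; first exact: bpolytope_conv.
  by rewrite uE !gr_conv //; [exact: Px.1|exact: Py.1|exact: Px.1|exact: Py.1].
have {zu}: (t / 2) *: x + (1 - t / 2) *: y = t *: x + (1 - t) *: y by rewrite zu.
move=> /ffunP E; apply/ffunP => e; move: (E e); rewrite !ffunE /GRing.scale /=.
move=> Ee; have : t * ((x e : R) - y e) = 0 by lra.
by move/eqP; rewrite mulf_eq0 gt_eqF //= subr_eq0 => /eqP.
Qed.

Theorem theorem29 (R : realType) (G : multigraph) (b : {ffun vert G -> R})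
    (hV : (0 < #|vert G|)%N) (hb : b != 0) (hb0 : forall v, 0 <= b v)
    (u : {ffun edge G -> R^o}) (hu : bpolytope b u) :
  (is_vertex (bpolytope b) u <->
   [set x | bpolytope b x /\ gr x = gr u] = [set u]) /\
  ([set x | bpolytope b x /\ gr x = gr u] = [set u] <->
   [set x | bpolytope b x /\ gr x \subset gr u] = [set u]).
Proof.
(* The equivalences follow from the cycle (i) to (iii) to (ii) to (i). *)
have i_iii : is_vertex (bpolytope b) u ->
    [set x | bpolytope b x /\ gr x \subset gr u] = [set u].
  move=> vu; apply/seteqP; split=> x /=; last by move=> ->.
  by case; exact: is_vertex_gr_sub.
have iii_ii : [set x | bpolytope b x /\ gr x \subset gr u] = [set u] ->
    [set x | bpolytope b x /\ gr x = gr u] = [set u].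
  move=> /seteqP[sub _]; apply/seteqP; split=> x /=; last by move=> ->.
  by move=> [Px xu]; apply: sub; rewrite /= xu.
have ii_i : [set x | bpolytope b x /\ gr x = gr u] = [set u] ->
    is_vertex (bpolytope b) u.
  by move=> /seteqP[sub _]; apply: is_vertex_gr_eq => // x Px xu; exact: sub.
split; split=> //.
- by move=> /i_iii/iii_ii.
- by move=> /ii_i/i_iii.
Qed.
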